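(* For every real $x$ and every integer $n\ge 0$, $$D_{n,\lambda}^{Y}(x)=n!\sum_{k=0}^{n}\frac{(-1)^{k}}{k!}E\big[\langle Y\rangle_{k,\lambda}\big]x^{n-k}.$$ Moreover, $$D_{0,\lambda}^{Y}(x)=1,\qquad D_{n,\lambda}^{Y}(x)=nx\,D_{n-1,\lambda}^{Y}(x)+(-1)^{n}E\big[\langle Y\rangle_{n,\lambda}\big]\quad (n\ge 1).$$
   Context: Let $\lambda$ be a nonzero real number. Set $(x)_{0,\lambda}=1$, $(x)_{k,\lambda}=x(x-\lambda)\cdots(x-(k-1)\lambda)$ and $\langle x\rangle_{0,\lambda}=1$, $\langle x\rangle_{k,\lambda}=x(x+\lambda)\cdots(x+(k-1)\lambda)$ for $k\ge 1$. The degenerate exponential is $e_{\lambda}^{x}(t)=\sum_{k\ge 0}(x)_{k,\lambda}\frac{t^{k}}{k!}$ (so $e_\lambda^x(t)=(1+\lambda t)^{x/\lambda}$ for $t$ near $0$). $Y$ is a real random variable whose moment generating function $E[e^{tY}]=\sum_{n\ge 0}E[Y^n]\frac{t^n}{n!}$ exists for $|t|<r$, for some $r>0$. $E$ denotes expectation. The probabilistic degenerate derangement polynomials of the second kind associated with $Y$, $D_{n,\lambda}^{Y}(x)$, are defined by $$\frac{1}{1-xt}E\big[e_{\lambda}^{-Y}(t)\big]=\sum_{n=0}^{\infty}D_{n,\lambda}^{Y}(x)\frac{t^{n}}{n!}$$ (power series in $t$ near $0$). Convention: $x^0=1$ for all $x$. *)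

(* Defs.v *)
From HB Require Import structures.
From mathcomp Require Import all_boot all_order all_algebra.
From mathcomp Require Import all_classical all_reals all_analysis.

Set Implicit Arguments.
Unset Strict Implicit.
Unset Printing Implicit Defensive.

Import Order.TTheory GRing.Theory Num.Theory.
Import numFieldNormedType.Exports.

Local Open Scope classical_set_scope.
Local Open Scope ring_scope.

(* (x)_{k,lambda} *)
Definition degenerate_falling (R : realType) (lambda x : R) (k : nat) : R :=
  \prod_(i < k) (x - i%:R * lambda).

(* <x>_{k,lambda} *)
Definition degenerate_rising (R : realType) (lambda x : R) (k : nat) : R :=
  \prod_(i < k) (x + i%:R * lambda).

(* e_lambda^x(t); the series converges when `|lambda * t| < 1, and the value
   is not meaningful at those t where it diverges. *)
Definition degenerate_exp (R : realType) (lambda x t : R) : R :=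
  limn (series (fun k => degenerate_falling lambda x k * (t ^+ k / k`!%:R))).

(* f(t) = \sum_n a_n t^n / n!  for all t in some neighbourhood of 0. *)
Definition is_egf (R : realType) (f : R -> R) (a : nat -> R) : Prop :=
  \forall t \near (0 : R),
    series (fun n => a n * (t ^+ n / n`!%:R)) @ \oo --> f t.

(* The integrability clause says that E[e_lambda^{-Y}(t)] exists and is finite
   for t near 0, so that [fine] loses no information in the second clause. *)
Definition derangement_egf (d : measure_display) (T : measurableType d)
    (R : realType) (P : probability T R) (Y : {RV P >-> R}) (lambda x : R)
    (a : nat -> R) : Prop :=
  (\forall t \near (0 : R),
     P.-integrable [set: T] (fun w => (degenerate_exp lambda (- Y w) t)%:E)) /\
  is_egf (fun t => (1 - x * t)^-1 *
                   fine ('E_P[fun w => degenerate_exp lambda (- Y w) t])) a.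

(* D_{n,lambda}^Y(x): the coefficient sequence determined by its generating
   function. When no such sequence exists, the value is the constant 0
   sequence. *)
Definition prob_degenerate_derangement (d : measure_display)
    (T : measurableType d) (R : realType) (P : probability T R)
    (Y : {RV P >-> R}) (lambda : R) (n : nat) (x : R) : R :=
  (xget (fun=> 0) [set a : nat -> R | derangement_egf Y lambda x a]) n.

(* Main.v *)
Require Import Defs.
From mathcomp Require Import all_boot all_order all_algebra.
From mathcomp Require Import all_classical all_reals all_analysis.
From mathcomp Require Import measurable_realfun ring lra.

Import Order.TTheory GRing.Theory Num.Theory.
Import numFieldNormedType.Exports.

Local Open Scope classical_set_scope.
Local Open Scope ring_scope.

(** Since [(-y)_{k,lambda} = (-1)^k <y>_{k,lambda}], the degenerate exponential
    [e_lambda^{-Y}(t)] is the series of [(-1)^k <Y>_{k,lambda} t^k / k!].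
    Once expectation and sum may be exchanged, its expectation is the
    exponential generating function of [b_k = (-1)^k E<Y>_{k,lambda}], and
    multiplying by the geometric series [1 / (1 - x t)] gives
    [n! \sum_(k <= n) b_k / k! x^(n-k)] as the [n]-th coefficient. The
    recurrence is the same product read as
    [(1 - x t) \sum_n D_n t^n / n! = \sum_n b_n t^n / n!].

    Three points need an argument.

    - The exchange of expectation and sum. From [z^k <= k! e^z] at
      [z = c (|y| + k |lambda|)] one gets
      [|<y>_{k,lambda}| / k! <= e^{c |y|} (e^{c |lambda|} / c)^k]
      ([degenerate_rising_bound]). For [c] inside the domain of the moment
      generating function [e^{c |Y|}] is integrable, so for small [t] the whole
      series is dominated by [2 e^{c |Y|}] and dominated convergence applies
      ([integral_degenerate_exp]).

    - The product with [1 / (1 - x t)] ([is_egf_div]). With [d_n] the product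
      coefficients, [d_{n+1} = x d_n + b_{n+1} / (n+1)!], so the partial sums
      satisfy [(1 - x t) S_{n+1} = B_{n+1} - x t d_n t^n]; it remains that
      [d_n t^n] tends to 0, which holds because [d_n] grows at most
      geometrically.

    - The generating function determines its coefficients ([is_egf_inj]), so
      that the sequence selected by [prob_degenerate_derangement] is the one
      computed above. *)

(** * Power series near the origin *)

Set Implicit Arguments.
Unset Strict Implicit.

(** The terms of a convergent series are bounded, so convergence at a single
    nonzero point already forces at most geometric growth. *)
Lemma power_series_coef_bound {R : realType} (c : nat -> R) :
  (\forall t \near (0 : R)^', cvgn (series (fun n => c n * t ^+ n))) ->
  exists K rho : R,
    [/\ 0 <= K, 0 < rho & forall n, `|c n| <= K * rho ^+ n].
Proof.
move=> ct.
have [t [t0 cvt]] : exists t : R, t != 0 /\ cvgn (series (fun n => c n * t ^+ n)).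
  near (0 : R)^' => t; exists t; split; near: t => //.
  exact: nbhs_dnbhs_neq.
have /cvgP/cvg_seq_bounded[M [_ /(_ (`|M| + 1))]] := cvg_series_cvg_0 cvt.
have M1 : M < `|M| + 1 by rewrite (le_lt_trans (ler_norm M))// ltrDl.
move=> /(_ M1) bM.
exists (`|M| + 1), `|t|^-1; split; rewrite ?addr_ge0 ?invr_gt0 ?normr_gt0//.
move=> n; rewrite exprVn ler_pdivlMr ?exprn_gt0 ?normr_gt0//.
by rewrite -normrX -normrM; exact: bM.
Unshelve. all: by end_near. Qed.

(** By geometric growth of the coefficients, the terms of index at least 1 add
    up to [O(|t|)]; let [t] tend to 0. Only [t != 0] is considered, so that the
    result can be applied again after division by [t]. *)
Lemma power_series0_coef0 {R : realType} (c : nat -> R) :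
  (\forall t \near (0 : R)^', series (fun n => c n * t ^+ n) @ \oo --> (0 : R)) ->
  c 0%N = 0.
Proof.
move=> ct.
have [] := @power_series_coef_bound R c.
  by apply: filterS ct => t /cvgP.
move=> K [rho [K0 rho0 cK]].
suff bnd : \forall t \near (0 : R)^', `|c 0%N| <= 2 * K * rho * `|t|.
  apply/eqP; rewrite -normr_le0.
  have cv : 2 * K * rho * `|t| @[t --> (0 : R)^'] --> (0 : R).
    have z : 0 = 2 * K * rho * `|0 : R| by rewrite normr0 mulr0.
    rewrite [X in _ --> X]z.
    apply: cvgM; first exact: cvg_cst.
    apply: cvg_norm; exact: cvg_within.
  by apply: (ler_cvg_to (cvg_cst `|c 0%N|) cv).
near=> t.
have cvt : series (fun n => c n * t ^+ n) @ \oo --> (0 : R) by near: t.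
have rt : rho * `|t| <= 2^-1.
  rewrite mulrC -ler_pdivlMr//; apply/ltW; near: t.
  by apply: dnbhs0_lt; rewrite divr_gt0.
have rt0 : 0 <= rho * `|t| by rewrite mulr_ge0// ltW.
have tail N : `|c 0%N - series (fun n => c n * t ^+ n) N.+1| <= 2 * K * rho * `|t|.
  rewrite /series/= big_nat_recl//= expr0 mulr1 opprD addrA subrr sub0r normrN.
  apply: le_trans (ler_norm_sum _ _ _) _.
  apply: (@le_trans _ _ (\sum_(0 <= i < N) (K * rho * `|t|) * 2^-1 ^+ i)).
    apply: ler_sum => i _; rewrite normrM normrX.
    apply: le_trans (ler_wpM2r _ (cK i.+1)) _; first by rewrite exprn_ge0.
    rewrite -!mulrA ler_wpM2l// -exprMn exprS mulrA ler_wpM2l//.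
    by apply: lerXn2r; rewrite ?nnegrE.
  have := @geometric_le_lim R N (K * rho * `|t|) 2^-1.
  rewrite /series/geometric/=.
  have -> : K * rho * `|t| / (1 - 2^-1) = 2 * K * rho * `|t| by field.
  apply.
  - by rewrite !mulr_ge0// ltW.
  - by rewrite invr_gt0.
  - by rewrite ger0_norm ?invr_ge0// invf_lt1// ltr1n.
have cvS : `|c 0%N - series (fun n => c n * t ^+ n) N.+1| @[N --> \oo] --> `|c 0%N|.
  rewrite -{2}[c 0%N]subr0; apply: cvg_norm; apply: cvgB; first exact: cvg_cst.
  by rewrite cvg_shiftS.
apply: (ler_cvg_to cvS (cvg_cst (2 * K * rho * `|t|))).
by near=> N; exact: tail.
Unshelve. all: by end_near. Qed.

(** Once the constant coefficient is known to vanish, division by [t] shifts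
    the series by one index. *)
Lemma power_series0_coefs0 {R : realType} (c : nat -> R) :
  (\forall t \near (0 : R)^', series (fun n => c n * t ^+ n) @ \oo --> (0 : R)) ->
  forall n, c n = 0.
Proof.
move=> + n; elim: n c => [|n IH] c ct; first exact: power_series0_coef0.
apply: (IH (fun k => c k.+1)).
have c0 := power_series0_coef0 ct.
near=> t.
have t0 : t != 0 by near: t; exact: nbhs_dnbhs_neq.
have cvt : series (fun n => c n * t ^+ n) @ \oo --> (0 : R) by near: t.
have -> : series (fun k => c k.+1 * t ^+ k) =
    (fun N => t^-1 * series (fun n => c n * t ^+ n) N.+1).
  apply/funext => N; rewrite /series/= big_nat_recl// c0 mul0r add0r mulr_sumr.
  by apply: eq_bigr => i _; rewrite exprS (mulrCA (c _)) mulKf.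
rewrite -[X in _ --> X](mulr0 t^-1); apply: cvgM; first exact: cvg_cst.
by rewrite (cvg_shiftS (series (fun n => c n * t ^+ n))).
Unshelve. all: by end_near. Qed.

Lemma is_egf_inj {R : realType} (f : R -> R) (a b : nat -> R) :
  is_egf f a -> is_egf f b -> a = b.
Proof.
move=> fa fb; apply/funext => n; apply/eqP; rewrite -subr_eq0.
have : (a n - b n) / n`!%:R = 0.
  apply: (@power_series0_coefs0 R (fun n => (a n - b n) / n`!%:R)).
  apply: nbhs_dnbhs; near=> t.
  have ta : series (fun n => a n * (t ^+ n / n`!%:R)) @ \oo --> f t by near: t.
  have tb : series (fun n => b n * (t ^+ n / n`!%:R)) @ \oo --> f t by near: t.
  rewrite -[X in _ --> X](subrr (f t)).
  have -> : series (fun n => (a n - b n) / n`!%:R * t ^+ n) =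
      series (fun n => a n * (t ^+ n / n`!%:R)) \-
      series (fun n => b n * (t ^+ n / n`!%:R)).
    apply/funext => N; rewrite /series/= -sumrB; apply: eq_bigr => i _.
    by rewrite -mulrBl -mulrA [_^-1 * _]mulrC.
  exact: cvgB.
move=> /eqP; rewrite mulf_eq0 invr_eq0 pnatr_eq0.
by rewrite [n`! == _]eqn0Ngt fact_gt0 orbF.
Unshelve. all: by end_near. Qed.

(** * Multiplying a generating function by a geometric series *)

(** The Cauchy product of [\sum_n b_n t^n / n!] and [\sum_n x^n t^n],
    normalised as an exponential generating function. *)
Definition egf_div_coef {R : realType} (x : R) (b : nat -> R) (n : nat) : R :=
  n`!%:R * \sum_(k < n.+1) b k / k`!%:R * x ^+ (n - k).

Lemma egf_div_coef0 {R : realType} (x : R) (b : nat -> R) :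
  egf_div_coef x b 0 = b 0%N.
Proof. by rewrite /egf_div_coef big_ord1 fact0 expr0 divr1 mul1r mulr1. Qed.

Lemma egf_div_coefS {R : realType} (x : R) (b : nat -> R) (n : nat) :
  egf_div_coef x b n.+1 = n.+1%:R * x * egf_div_coef x b n + b n.+1.
Proof.
rewrite /egf_div_coef big_ord_recr/= subnn expr0 mulr1 mulrDr.
congr (_ + _); last by rewrite mulrC divfK// pnatr_eq0 -lt0n fact_gt0.
rewrite factS natrM -!mulrA; congr (_ * _); rewrite mulrCA; congr (_ * _).
rewrite mulr_sumr; apply: eq_bigr => k _.
by rewrite subSn ?exprS -1?ltnS// mulrCA.
Qed.

(** The recurrence for the coefficients makes
    [(1 - x t) * \sum_(k <= n) delta_k t^k] telescope, up to the boundary term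
    [x t delta_n t^n]; no rearrangement of a double series is involved. *)
Lemma is_egf_div {R : realType} (x : R) (f : R -> R) (b : nat -> R) :
  is_egf f b -> is_egf (fun t => (1 - x * t)^-1 * f t) (egf_div_coef x b).
Proof.
move=> fb.
pose beta n := b n / n`!%:R.
pose delta n := egf_div_coef x b n / n`!%:R.
have fact_neq0 n : n`!%:R != 0 :> R by rewrite pnatr_eq0 -lt0n fact_gt0.
have delta0 : delta 0%N = beta 0%N by rewrite /delta egf_div_coef0.
have deltaS n : delta n.+1 = x * delta n + beta n.+1.
  rewrite /delta egf_div_coefS mulrDl; congr (_ + _).
  by rewrite factS natrM -[_ * x * _]mulrA -mulf_div divff// mul1r mulrA.
have termE (a : nat -> R) t :
    (fun n => a n * (t ^+ n / n`!%:R)) = (fun n => a n / n`!%:R * t ^+ n).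
  by apply/funext => n; rewrite mulrAC mulrA.
have [K [rho [K0 rho0 betaK]]] : exists K rho : R,
    [/\ 0 <= K, 0 < rho & forall n, `|beta n| <= K * rho ^+ n].
  apply: power_series_coef_bound; apply: nbhs_dnbhs.
  by apply: filterS fb => t /cvgP; rewrite termE.
(* Since [|x| <= s / 2] and [rho <= s], the bound [2 K s^n] propagates along
   [delta_{n+1} = x delta_n + beta_{n+1}]: each summand contributes at most
   [K s^(n+1)]. *)
pose s := 2 * `|x| + rho.
have s0 : 0 < s by rewrite ltr_wpDl// mulr_ge0.
have deltaK n : `|delta n| <= 2 * K * s ^+ n.
  elim: n => [|n IH].
    rewrite delta0 (le_trans (betaK 0%N))// !expr0 !mulr1.
    by rewrite ler_peMl// ler1n.
  rewrite deltaS (le_trans (ler_normD _ _))// normrM.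
  have xs : `|x| <= s / 2 by rewrite /s; lra.
  have rs : rho ^+ n.+1 <= s ^+ n.+1.
    have rs1 : rho <= s by rewrite /s lerDr mulr_ge0.
    by apply: lerXn2r => //; rewrite nnegrE ltW.
  have -> : 2 * K * s ^+ n.+1 = s / 2 * (2 * K * s ^+ n) + K * s ^+ n.+1.
    by rewrite exprS; field.
  apply: lerD; first exact: ler_pM.
  by rewrite (le_trans (betaK _))// ler_wpM2l.
rewrite /is_egf; near=> t; rewrite termE -/delta.
have ft : series (fun n => beta n * t ^+ n) @ \oo --> f t.
  by rewrite -termE; near: t.
have st : s * `|t| < 1.
  by rewrite mulrC -ltr_pdivlMr//; near: t; apply: (@nbhs0_lt R R^o); rewrite divr_gt0.
have xt : 1 - x * t != 0.
  have : `|x * t| < 1.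
    rewrite normrM (le_lt_trans _ st)// ler_wpM2r//.
    by rewrite /s; have := normr_ge0 x; lra.
  by rewrite subr_eq0; apply: contraTneq => <-; rewrite normr1 ltxx.
have delta_t : (delta n * t ^+ n) @[n --> \oo] --> (0 : R).
  apply: norm_cvg0.
  apply: (@squeeze_cvgr _ _ _ _ (fun=> 0) (geometric (2 * K) (s * `|t|))).
  - near=> n; rewrite normr_ge0/= normrM normrX exprMn mulrA.
    by rewrite ler_wpM2r ?exprn_ge0.
  - exact: cvg_cst.
  - by apply: cvg_geometric; rewrite ger0_norm// mulr_ge0// ltW.
have partial N : series (fun n => delta n * t ^+ n) N.+1 =
    (1 - x * t)^-1 * (series (fun n => beta n * t ^+ n) N.+1 -
                      x * t * (delta N * t ^+ N)).
  apply: (canRL (mulKf xt)).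
  elim: N => [|N IH]; first by rewrite /series/= !big_nat1 delta0; ring.
  rewrite !(seriesSr _ N.+1)/= mulrDr IH deltaS exprS; ring.
rewrite -cvg_shiftS; under eq_cvg do rewrite /= partial.
apply: cvgM; first exact: cvg_cst.
rewrite -[X in _ --> X]subr0; apply: cvgB; first by rewrite cvg_shiftS.
rewrite -(mulr0 (x * t)); apply: cvgM => //; exact: cvg_cst.
Unshelve. all: by end_near. Qed.

(** * Bounds on the degenerate exponential series *)

Lemma degenerate_fallingN {R : realType} (lambda y : R) (k : nat) :
  degenerate_falling lambda (- y) k = (-1) ^+ k * degenerate_rising lambda y k.
Proof.
rewrite /degenerate_falling /degenerate_rising.
rewrite -[k in (-1) ^+ k]card_ord -prodr_const -big_split/=.
by apply: eq_bigr => i _; rewrite mulN1r opprD.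
Qed.

Lemma exprn_le_fact_expR {R : realType} (z : R) (n : nat) :
  0 <= z -> z ^+ n <= n`!%:R * expR z.
Proof.
case: n => [|n] z0.
  by rewrite fact0 expr0 mul1r; have := @expR_ge1Dx R z; lra.
rewrite mulrC -ler_pdivrMr ?ltr0n ?fact_gt0//.
by apply: le_trans (expR_ge1Dxn n z0); rewrite lerDr.
Qed.

(** Every factor of the product is at most [|y| + k |lambda|] in absolute
    value, and [(c (|y| + k |lambda|))^k <= k! e^(c (|y| + k |lambda|))]. The
    dependence on [y] is confined to [e^(c |y|)], uniformly in [k], which is
    what makes domination under the expectation possible. *)
Lemma degenerate_rising_bound {R : realType} (lambda c y : R) (k : nat) :
  0 < c -> `|degenerate_rising lambda y k| <=
    k`!%:R * (expR (c * `|y|) * (expR (c * `|lambda|) / c) ^+ k).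
Proof.
move=> c0.
have -> : k`!%:R * (expR (c * `|y|) * (expR (c * `|lambda|) / c) ^+ k) =
    k`!%:R * expR (c * (`|y| + k%:R * `|lambda|)) * c^-1 ^+ k.
  rewrite exprMn -expRM_natl !mulrA; congr (_ * _); rewrite -mulrA -expRD.
  by congr (_ * expR _); ring.
apply: (@le_trans _ _ ((`|y| + k%:R * `|lambda|) ^+ k)).
  rewrite /degenerate_rising normr_prod.
  rewrite -[k in _ ^+ k]card_ord -prodr_const; apply: ler_prod => i _.
  rewrite normr_ge0/= (le_trans (ler_normD _ _))// lerD2l normrM normr_nat.
  by rewrite ler_wpM2r// ler_nat ltnW.
rewrite exprVn ler_pdivlMr ?exprn_gt0// -exprMn mulrC.
by rewrite [_ ^+ k](_ : _ = (c * (`|y| + k%:R * `|lambda|)) ^+ k) ?exprn_le_fact_expR;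
  rewrite // mulr_ge0 ?addr_ge0 ?mulr_ge0 // ltW.
Qed.

Lemma degenerate_exp_term_bound {R : realType} (lambda c y t : R) (k : nat) :
  0 < c -> `|t| * (expR (c * `|lambda|) / c) <= 2^-1 ->
  `|degenerate_falling lambda (- y) k * (t ^+ k / k`!%:R)| <=
    expR (c * `|y|) * 2^-1 ^+ k.
Proof.
move=> c0 tc; rewrite degenerate_fallingN !normrM normrX normrN1 expr1n mul1r.
have k0 : 0 < k`!%:R :> R by rewrite ltr0n fact_gt0.
rewrite normfV (gtr0_norm k0) normrX.
apply: le_trans (ler_wpM2r _ (degenerate_rising_bound lambda y k c0)) _.
  by rewrite divr_ge0 ?exprn_ge0// ltW.
rewrite [leLHS](_ : _ = expR (c * `|y|) *
    (`|t| * (expR (c * `|lambda|) / c)) ^+ k); last first.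
  by rewrite (exprMn _ `|t|); field; rewrite gt_eqF.
rewrite ler_wpM2l ?expR_ge0//; apply: lerXn2r => //; rewrite nnegrE//.
by rewrite mulr_ge0// divr_ge0 ?expR_ge0// ltW.
Qed.

Lemma series_half_le2 {R : realType} (N : nat) : series (fun k => 2^-1 ^+ k : R) N <= 2.
Proof.
have := @geometric_le_lim R N 1 2^-1.
rewrite exprn_geometric (_ : 1 / (1 - 2^-1) = 2 :> R); last by field.
apply => //; rewrite ?invr_gt0//.
by rewrite ger0_norm ?invr_ge0// invf_lt1// ltr1n.
Qed.

Lemma cvg_degenerate_exp {R : realType} (lambda c y t : R) :
  0 < c -> `|t| * (expR (c * `|lambda|) / c) <= 2^-1 ->
  series (fun k => degenerate_falling lambda (- y) k * (t ^+ k / k`!%:R)) @ \oo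
    --> degenerate_exp lambda (- y) t.
Proof.
move=> c0 tc; apply: normed_cvg.
apply: (@series_le_cvg _ _ (geometric (expR (c * `|y|)) 2^-1)) => [k|k|k|] //=.
- exact: degenerate_exp_term_bound c0 tc.
- apply: is_cvg_geometric_series.
  by rewrite ger0_norm ?invr_ge0// invf_lt1// ltr1n.
Qed.

(** * Expectation of the degenerate exponential *)

Section ProbabilisticDegenerateExp.
Context (d : measure_display) (T : measurableType d) (R : realType)
  (P : probability T R) (Y : {RV P >-> R}).

(** [e^(c |Y|) <= e^(c Y) + e^(- c Y)], with both [c] and [- c] in the domain of
    the moment generating function. *)
Lemma integrable_expR_norm (r : R) :
  0 < r -> (forall t : R, `|t| < r -> ('M_P Y t < +oo)%E) ->
  exists2 c : R, 0 < c &
    P.-integrable [set: T] (EFin \o (fun w => expR (c * `|Y w|))).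
Proof.
move=> r0 mgf; exists (r / 2); first by rewrite divr_gt0.
have mexp (t : R) : measurable_fun [set: T] (fun w => expR (t * Y w)).
  by apply: measurableT_comp => //; exact: measurable_funM.
have iexp (t : R) : `|t| < r ->
    P.-integrable [set: T] (EFin \o (fun w => expR (t * Y w))).
  move=> /mgf; rewrite /mmt_gen_fun unlock => Mt.
  apply/integrableP; split; first exact/measurable_EFinP.
  apply: le_lt_trans Mt; rewrite le_eqVlt; apply/orP; left; apply/eqP.
  apply: eq_integral => w _ /=.
  by rewrite ger0_norm ?expR_ge0// mulrC.
apply: (@le_integrable _ _ _ _ _ measurableT _
    (fun w => (expR (r / 2 * Y w))%:E + (expR (- (r / 2) * Y w))%:E)%E).
- apply/measurable_EFinP; apply: measurableT_comp => //.
  by apply: measurable_funM => //; exact: measurableT_comp.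
- move=> w _ /=; rewrite lee_fin (ger0_norm (expR_ge0 _)) (ger0_norm (addr_ge0 (expR_ge0 _) (expR_ge0 _))).
  have [y0|y0] := ger0P (Y w); first by rewrite lerDl expR_ge0.
  by rewrite mulrN mulNr lerDr expR_ge0.
- by apply: integrableD => //; apply: iexp; rewrite ?normrN gtr0_norm; lra.
Qed.

Context (lambda c : R) (c0 : 0 < c)
  (ic : P.-integrable [set: T] (EFin \o (fun w => expR (c * `|Y w|)))).

Lemma measurable_degenerate_rising (k : nat) :
  measurable_fun [set: T] (fun w => degenerate_rising lambda (Y w) k).
Proof.
by apply: measurable_prod => i _; apply: measurable_funD.
Qed.

Lemma integrable_degenerate_rising (k : nat) :
  P.-integrable [set: T] (EFin \o (fun w => degenerate_rising lambda (Y w) k)).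
Proof.
set C := k`!%:R * (expR (c * `|lambda|) / c) ^+ k.
apply: (@le_integrable _ _ _ _ _ measurableT _
    (fun w => C%:E * (expR (c * `|Y w|))%:E)%E).
- by apply/measurable_EFinP; exact: measurable_degenerate_rising.
- move=> w _ /=; rewrite lee_fin.
  apply: le_trans (degenerate_rising_bound lambda (Y w) k c0) _.
  by rewrite mulrCA mulrC ler_norm.
- exact: (@integrableZl _ _ _ _ _ measurableT C _ ic).
Qed.

Lemma expectation_degenerate_rising (k : nat) :
  'E_P[fun w => degenerate_rising lambda (Y w) k]%E =
  (\int[P]_w degenerate_rising lambda (Y w) k)%:E.
Proof.
rewrite unlock /Rintegral fineK//.
exact: (integrable_fin_num measurableT (integrable_degenerate_rising k)).
Qed.

(** Dominated convergence for the partial sums, with dominating function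
    [2 e^(c |Y|)]; the 2 is [\sum_k 2^-k]. *)
Lemma integral_degenerate_exp (t : R) :
  `|t| * (expR (c * `|lambda|) / c) <= 2^-1 ->
  P.-integrable [set: T] (fun w => (degenerate_exp lambda (- Y w) t)%:E) /\
  series (fun k => (-1) ^+ k * (\int[P]_w degenerate_rising lambda (Y w) k) *
                   (t ^+ k / k`!%:R)) @ \oo
    --> fine 'E_P[fun w => degenerate_exp lambda (- Y w) t]%E.
Proof.
move=> tc.
pose u k w := degenerate_falling lambda (- Y w) k * (t ^+ k / k`!%:R).
have iu k : P.-integrable [set: T] (EFin \o u k).
  have := @integrableZl _ _ _ _ _ measurableT ((-1) ^+ k * (t ^+ k / k`!%:R)) _
    (integrable_degenerate_rising k).
  apply: eq_integrable => // w _.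
  by rewrite /u/= degenerate_fallingN -EFinM mulrAC.
have mu k : measurable_fun [set: T] (u k).
  by apply/measurable_EFinP; exact: (measurable_int P (iu k)).
have cvu w : series (u^~ w) @ \oo --> degenerate_exp lambda (- Y w) t.
  exact: cvg_degenerate_exp c0 tc.
have mS N : measurable_fun [set: T] (fun w => series (u^~ w) N).
  exact: measurable_sum.
have [] := @dominated_convergence _ _ R P _ measurableT
  (fun N w => (series (u^~ w) N)%:E) (fun w => (degenerate_exp lambda (- Y w) t)%:E)
  (fun w => (2%:E * (expR (c * `|Y w|))%:E)%E).
- by move=> N; apply/measurable_EFinP.
- apply/measurable_EFinP.
  by apply: (measurable_realfun.measurable_fun_cvg _ (fun w _ => cvu w)).
- by apply: aeW => w _; apply: cvg_EFin; [exact: nearW|exact: cvu].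
- exact: integrableZl.
- apply: aeW => w N _ /=; rewrite lee_fin /series/=.
  apply: le_trans (ler_norm_sum _ _ _) _.
  apply: (@le_trans _ _ (\sum_(0 <= k < N) expR (c * `|Y w|) * 2^-1 ^+ k)).
    by apply: ler_sum => k _; exact: degenerate_exp_term_bound c0 tc.
  by rewrite -mulr_sumr mulrC ler_wpM2r ?expR_ge0//; exact: series_half_le2.
move=> iexp _ cvint; split=> //.
rewrite unlock.
rewrite -(fineK (integrable_fin_num measurableT iexp)) in cvint.
have -> : series (fun k => (-1) ^+ k *
    (\int[P]_w degenerate_rising lambda (Y w) k) * (t ^+ k / k`!%:R)) =
    fine \o (fun N => \int[P]_w (series (u^~ w) N)%:E)%E; last exact: fine_cvg cvint.
apply/funext => N /=; rewrite /series/=.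
under eq_integral do rewrite -sumEFin.
rewrite (integral_sum measurableT (fun k => iu k)).
rewrite -sum_fine => [|k _]; last exact: (integrable_fin_num measurableT (iu k)).
apply: eq_bigr => k _; rewrite mulrAC -RintegralZl//; last first.
  exact: integrable_degenerate_rising.
by apply: eq_Rintegral => w _; rewrite /u degenerate_fallingN mulrAC.
Qed.
End ProbabilisticDegenerateExp.

Unset Implicit Arguments.
Set Strict Implicit.

Theorem theorem2p10 (d : measure_display) (T : measurableType d)
    (R : realType) (P : probability T R) (Y : {RV P >-> R}) (lambda : R)
    (lambda_neq0 : lambda != 0)
    (mgfY : exists2 r : R, 0 < r &
      forall t : R, `|t| < r -> ('M_P Y t < +oo)%E) :
  (forall (x : R) (n : nat),
    (prob_degenerate_derangement Y lambda n x)%:E =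
    ((n`!%:R)%:E * \sum_(k < n.+1)
       (((-1) ^+ k / k`!%:R)%:E *
        'E_P[fun w => degenerate_rising lambda (Y w) k] *
        (x ^+ (n - k))%:E))%E) /\
  (forall x : R, prob_degenerate_derangement Y lambda 0 x = 1) /\
  (forall (x : R) (n : nat), (1 <= n)%N ->
    (prob_degenerate_derangement Y lambda n x)%:E =
    ((n%:R * x * prob_degenerate_derangement Y lambda n.-1 x)%:E +
     ((-1) ^+ n)%:E * 'E_P[fun w => degenerate_rising lambda (Y w) n])%E).
Proof.
have [r r0 /(integrable_expR_norm r0)[c c0 ic]] := mgfY.
pose b k := (-1) ^+ k * \int[P]_w degenerate_rising lambda (Y w) k.
have small : \forall t \near (0 : R),
    `|t| * (expR (c * `|lambda|) / c) <= 2^-1.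
  near=> t; rewrite -ler_pdivlMr ?divr_gt0 ?expR_gt0//; apply/ltW; near: t.
  by apply: (@nbhs0_lt R R^o); rewrite !divr_gt0 ?expR_gt0 ?invr_gt0.
have egf_b : is_egf
    (fun t => fine 'E_P[fun w => degenerate_exp lambda (- Y w) t]%E) b.
  by apply: filterS small => t /(integral_degenerate_exp c0 ic)[].
have DE x n : prob_degenerate_derangement Y lambda n x = egf_div_coef x b n.
  have egf_x : derangement_egf Y lambda x (egf_div_coef x b).
    split; last exact: is_egf_div.
    by apply: filterS small => t /(integral_degenerate_exp c0 ic)[].
  have [_ egf_get] : derangement_egf Y lambda x
      (xget (fun=> 0) [set a | derangement_egf Y lambda x a]).
    exact: (@xgetI _ _ [set a | derangement_egf Y lambda x a] _ egf_x).
  congr (_ n); apply: is_egf_inj egf_get _; exact: egf_x.2.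
have ErisingE := expectation_degenerate_rising lambda c0 ic.
split=> [x n|]; [|split=> [x|x [//|n] _]]; rewrite ?DE.
- rewrite /egf_div_coef EFinM -sumEFin; congr (_ * _)%E; apply: eq_bigr => k _.
  by rewrite ErisingE -!EFinM /b (mulrAC ((-1) ^+ k)).
- rewrite egf_div_coef0 /b expr0 mul1r.
  apply: EFin_inj; rewrite -ErisingE -[RHS](expectation_cst P 1).
  by congr expectation; apply/funext => w; rewrite /degenerate_rising big_ord0.
- by rewrite egf_div_coefS EFinD ErisingE -EFinM.
Unshelve. all: by end_near. Qed.
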